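(* Let $n,k$ be positive integers, let $f_1(\mathbf x;\mathbf p),\ldots,f_n(\mathbf x;\mathbf p)\in\mathbb C[x_1,\ldots,x_n,p_1,\ldots,p_k]$, and for $\mathbf q\in\mathbb C^k$ let $F(\mathbf x;\mathbf q)=(f_1(\mathbf x;\mathbf q),\ldots,f_n(\mathbf x;\mathbf q))$ be the system of $n$ polynomials in the $n$ variables $\mathbf x=(x_1,\ldots,x_n)$ obtained by substituting $\mathbf p=\mathbf q$. For $\mathbf q\in\mathbb C^k$ denote $$N(\mathbf q):=\#\{\mathbf x\in\mathbb C^n \mid \mathbf x \text{ is a regular zero of } F(\mathbf x;\mathbf q)\},$$ and let $N:=\sup_{\mathbf q\in\mathbb C^k}N(\mathbf q)$. Then $N<\infty$, and there exists a proper algebraic subvariety $\Delta\subsetneq\mathbb C^k$ such that $N(\mathbf q)=N$ for all $\mathbf q\in\mathbb C^k\setminus\Delta$.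
   Context: Here $\mathbf x=(x_1,\ldots,x_n)$ are variables and $\mathbf p=(p_1,\ldots,p_k)$ are parameters. A point $\mathbf x\in\mathbb C^n$ is a zero of $F(\mathbf x;\mathbf q)$ if $f_1(\mathbf x;\mathbf q)=\cdots=f_n(\mathbf x;\mathbf q)=0$. A zero $\mathbf x$ of $F(\mathbf x;\mathbf q)$ is called regular if the Jacobian determinant $\det\big(\tfrac{\partial f_i}{\partial x_j}\big)_{1\le i,j\le n}$ (derivatives with respect to the variables $\mathbf x$ only) does not vanish at $(\mathbf x,\mathbf q)$. An algebraic subvariety of $\mathbb C^k$ is the common zero set of a set of polynomials in $\mathbb C[p_1,\ldots,p_k]$ (not necessarily irreducible, possibly empty). *)

(* Defs.v *)
From HB Require Import structures.
From mathcomp Require Import all_boot all_order all_algebra.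
From mathcomp Require Import complex mpoly.
From mathcomp Require Import boolp classical_sets cardinality reals.
From mathcomp Require Import constructive_ereal ereal counting_measure.

Set Implicit Arguments.
Unset Strict Implicit.
Unset Printing Implicit Defensive.

Local Open Scope ring_scope.
Local Open Scope classical_set_scope.

(* Among the n + k indeterminates of f i, the first n (indices lshift k j) are
   the variables x_j and the last k (indices rshift n l) are the parameters
   p_l; accordingly the point (x, q) is the row vector row_mx x q. *)
Section ParametricSystem.
Context {R : realType} {n k : nat}.
Variable f : 'I_n -> {mpoly R[i][n + k]}.

Definition eval_at (g : {mpoly R[i][n + k]}) (x : 'rV[R[i]]_n)
    (q : 'rV[R[i]]_k) : R[i] :=
  g.@[row_mx x q ord0].

Definition is_zero (q : 'rV[R[i]]_k) (x : 'rV[R[i]]_n) : Prop :=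
  forall i, eval_at (f i) x q = 0.

Definition jacobian (x : 'rV[R[i]]_n) (q : 'rV[R[i]]_k) : 'M[R[i]]_n :=
  \matrix_(i, j) eval_at ((f i)^`M(lshift k j)) x q.

Definition is_regular_zero (q : 'rV[R[i]]_k) (x : 'rV[R[i]]_n) : Prop :=
  is_zero q x /\ \det (jacobian x q) <> 0.

(* counting A is the number of elements of A, and +oo when A is infinite *)
Definition nb_regular_zeros (q : 'rV[R[i]]_k) : \bar R :=
  counting [set x | is_regular_zero q x].

Definition sup_nb_regular_zeros : \bar R := ereal_sup (range nb_regular_zeros).

End ParametricSystem.

Definition algebraic_subvariety {R : realType} {k : nat}
    (D : set 'rV[R[i]]_k) : Prop :=
  exists S : set {mpoly R[i][k]},
    D = [set q | forall g, S g -> g.@[q ord0] = 0].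

(* Main.v *)
Require Import Defs.
From mathcomp Require Import all_boot all_order all_algebra ssrAC finmap.
From mathcomp Require Import closed_field complex mpoly ring lra zify.
From mathcomp Require Import boolp classical_sets cardinality reals.
From mathcomp Require Import constructive_ereal ereal counting_measure.

(** Two facts about regular zeros carry the proof.

    Persistence.  A regular zero x0 of F(.; q0) survives small perturbations:
    for q close to q0 and t close to 0, and for any polynomials g_i, the system
    f_i(.; q) + t g_i has a zero close to x0 at which the Jacobian determinant
    of F is still nonzero ([regular_zero_persists]).  This is the inverse
    function argument: polynomials are strictly differentiable
    ([mpoly_strict_diff]), so the chord iteration with the inverse of the
    Jacobian matrix at x0 is a contraction of a small closed ball ([newton]).
    As distinct zeros lie in disjoint balls, m distinct regular zeros at q0
    give m distinct zeros of the perturbed system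
    ([has_regular_zeros_perturb]).

    Boundedness.  Let d bound the degrees of the f_i.  Perturbing F(.; q) by
    t x_i^(d+1), the zeros of the perturbed system are points where x_i^(d+1)
    is a polynomial of degree at most d, so that, by induction on the degree,
    every polynomial function on finitely many of them is a linear combination
    of the (d+1)^n monomials with all exponents at most d.  Polynomials
    separate points, hence there are at most (d+1)^n such zeros
    ([nb_zeros_perturbed]).  By persistence N(q) <= (d+1)^n for all q, so the
    supremum N is a natural number, attained at some q0.

    It remains to see that N(q) >= N for generic q.  The condition N(q) >= N is
    a first-order formula in the coordinates of q; by quantifier elimination
    over the algebraically closed field of complex numbers, either it or its
    negation holds outside the zero set of a nonzero polynomial g
    ([generically_definable]).  By persistence the condition holds on a
    neighbourhood of q0, and a nonzero polynomial cannot vanish on a whole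
    neighbourhood ([mpoly_nonroot_in]), so it is the condition itself that holds
    where g does not vanish: Delta is the hypersurface g = 0. *)

Set Implicit Arguments.
Unset Strict Implicit.
Unset Printing Implicit Defensive.

Import Order.TTheory GRing.Theory Num.Theory.

Local Open Scope ring_scope.

Local Notation nc := Normc.normc.

(** * Definable predicates over an algebraically closed field *)

Section Definable.
Variable F : closedFieldType.

(** The predicates on valuations that are defined by a first-order formula with
    parameters in F; the variable of index i reads the i-th entry of the
    valuation, which is 0 beyond its length. *)
Definition definable (P : seq F -> Prop) : Prop :=
  exists phi : GRing.formula F, forall e, GRing.holds e phi <-> P e.

Lemma definable_ext (P Q : seq F -> Prop) :
  (forall e, P e <-> Q e) -> definable P -> definable Q.
Proof. by move=> PQ [phi h]; exists phi => e; rewrite h. Qed.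

Lemma definable_and (P Q : seq F -> Prop) :
  definable P -> definable Q -> definable (fun e => P e /\ Q e).
Proof.
by move=> [p hp] [q hq]; exists (GRing.And p q) => e /=; rewrite hp hq.
Qed.

Lemma definable_not (P : seq F -> Prop) :
  definable P -> definable (fun e => ~ P e).
Proof. by move=> [p hp]; exists (GRing.Not p) => e /=; rewrite hp. Qed.

Lemma definable_forall (I : finType) (P : I -> seq F -> Prop) :
  (forall i, definable (P i)) -> definable (fun e => forall i, P i e).
Proof.
move=> dP.
apply: (@definable_ext (fun e => forall i, i \in enum I -> P i e)).
  by move=> e; split=> h i; [apply: h; rewrite mem_enum | move=> _].
elim: (enum I) => [|i s IHs]; first by exists (GRing.Bool true).
apply: (definable_ext _ (definable_and (dP i) IHs)) => e; split.
  by move=> [h hs] j; rewrite inE => /orP[/eqP->|/hs].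
by move=> h; split=> [|j js]; apply: h; rewrite inE ?eqxx ?js ?orbT.
Qed.

Lemma definable_exists (xs : seq nat) (P : seq F -> Prop) :
  definable P ->
  definable (fun e => exists2 e' : seq F,
    (forall x, x \notin xs -> e`_x = e'`_x) & P e').
Proof.
move=> [p hp]; exists (foldr GRing.Exists p xs) => e.
rewrite -GRing.foldExistsP; by split=> -[e' ee' /hp Pe']; exists e'.
Qed.

(** A polynomial, with its i-th indeterminate renamed to the variable of index
    w i, is the value of a term. *)
Lemma mpoly_term (N : nat) (w : 'I_N -> nat) (p : {mpoly F[N]}) :
  exists t : GRing.term F, forall e, GRing.eval e t = p.@[fun i => e`_(w i)].
Proof.
elim/mpolyind: p => [|c m p _ _ [t ht]].
  by exists (GRing.Const 0) => e /=; rewrite meval0.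
pose X := foldr (fun i u => GRing.Mul (GRing.Exp (GRing.Var F (w i)) (m i)) u)
  (GRing.Const 1) (index_enum 'I_N).
exists (GRing.Add (GRing.Mul (GRing.Const c) X) t) => e /=.
rewrite ht mevalD mevalZ mevalX; congr (_ * _ + _); rewrite /X.
elim: (index_enum _) => [|i s IHs] /=; first by rewrite big_nil.
by rewrite big_cons IHs.
Qed.

Lemma definable_mpoly_root (N : nat) (w : 'I_N -> nat) (p : {mpoly F[N]}) :
  definable (fun e => p.@[fun i => e`_(w i)] = 0).
Proof.
have [t ht] := mpoly_term w p.
by exists (GRing.Equal t (GRing.Const 0)) => e /=; rewrite ht.
Qed.

Section Generic.
Variable k : nat.

(** The valuation giving to the first k variables the coordinates of v, and 0 to
    the other ones. *)
Definition env_of (v : 'I_k -> F) : seq F := [seq v i | i <- enum 'I_k].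

Lemma nth_env_of v (l : 'I_k) : (env_of v)`_l = v l.
Proof. by rewrite (nth_map l) ?size_enum_ord// nth_ord_enum. Qed.

Lemma rterm_mpoly (t : GRing.term F) : GRing.rterm t ->
  exists p : {mpoly F[k]}, forall v, GRing.eval (env_of v) t = p.@[v].
Proof.
elim: t => //=.
- move=> x _; have [xk|kx] := ltnP x k.
    exists 'X_(Ordinal xk) => v; rewrite mevalXU.
    exact: (nth_env_of v (Ordinal xk)).
  exists 0 => v; rewrite meval0 nth_default// size_map size_enum_ord//.
- by move=> c _; exists c%:MP => v; rewrite mevalC.
- by move=> c _; exists c%:R => v; rewrite mevalMn meval1.
- move=> t1 IH1 t2 IH2 /andP[/IH1[p1 h1] /IH2[p2 h2]].
  by exists (p1 + p2) => v; rewrite mevalD h1 h2.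
- by move=> t1 IH1 /IH1[p1 h1]; exists (- p1) => v; rewrite mevalN h1.
- by move=> t1 IH1 j /IH1[p1 h1]; exists (p1 *+ j) => v; rewrite mevalMn h1.
- move=> t1 IH1 t2 IH2 /andP[/IH1[p1 h1] /IH2[p2 h2]].
  by exists (p1 * p2) => v; rewrite mevalM h1 h2.
- by move=> t1 IH1 j /IH1[p1 h1]; exists (p1 ^+ j) => v; rewrite rmorphXn/= h1.
Qed.

(** P holds on a nonempty basic Zariski open subset of the affine space. *)
Definition generically (P : ('I_k -> F) -> Prop) : Prop :=
  exists2 g : {mpoly F[k]}, g != 0 & forall v, g.@[v] != 0 -> P v.

Lemma generically_imp (P Q : ('I_k -> F) -> Prop) :
  (forall v, P v -> Q v) -> generically P -> generically Q.
Proof. by move=> PQ [g g0 h]; exists g => // v /h /PQ. Qed.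

Lemma generically_and (P Q : ('I_k -> F) -> Prop) :
  generically P -> generically Q -> generically (fun v => P v /\ Q v).
Proof.
move=> [g g0 hg] [h h0 hh]; exists (g * h); first by rewrite mulf_neq0.
move=> v; rewrite mevalM mulf_eq0 negb_or => /andP[gv hv].
by split; [apply: hg | apply: hh].
Qed.

(** Since the affine space is irreducible, any two nonempty Zariski open sets
    meet, so the alternative is stable under all Boolean connectives. *)
Lemma generically_qf (phi : GRing.formula F) :
  GRing.qf_form phi -> GRing.rformula phi ->
  generically (fun v => GRing.qf_eval (env_of v) phi) \/
  generically (fun v => ~~ GRing.qf_eval (env_of v) phi).
Proof.
elim: phi => //=.
- by move=> [] _ _; [left|right]; exists 1; rewrite ?oner_neq0.
- move=> t1 t2 _ /andP[/rterm_mpoly[p1 h1] /rterm_mpoly[p2 h2]].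
  have [e12|n12] := eqVneq p1 p2; [left|right].
    by exists 1; rewrite ?oner_neq0// => v _; rewrite h1 h2 e12.
  exists (p1 - p2); first by rewrite subr_eq0.
  by move=> v; rewrite mevalB subr_eq0 h1 h2.
- move=> p1 IH1 p2 IH2 /andP[q1 q2] /andP[r1 r2].
  case: (IH1 q1 r1) => g1; last first.
    by right; apply: generically_imp g1 => v /negbTE->.
  case: (IH2 q2 r2) => g2; last first.
    by right; apply: generically_imp g2 => v /negbTE->; rewrite andbF.
  by left; apply: generically_imp (generically_and g1 g2) => v [-> ->].
- move=> p1 IH1 p2 IH2 /andP[q1 q2] /andP[r1 r2].
  case: (IH1 q1 r1) => g1.
    by left; apply: generically_imp g1 => v ->.
  case: (IH2 q2 r2) => g2.
    by left; apply: generically_imp g2 => v ->; rewrite orbT.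
  right; apply: generically_imp (generically_and g1 g2) => v [].
  by rewrite negb_or => -> ->.
- move=> p1 IH1 p2 IH2 /andP[q1 q2] /andP[r1 r2].
  case: (IH1 q1 r1) => g1; last first.
    by left; apply: generically_imp g1 => v /negbTE->.
  case: (IH2 q2 r2) => g2.
    by left; apply: generically_imp g2 => v ->; rewrite implybT.
  right; apply: generically_imp (generically_and g1 g2) => v [].
  by rewrite negb_imply => -> ->.
- move=> p1 IH1 q1 r1; case: (IH1 q1 r1) => g1; [right|left] => //.
  by apply: generically_imp g1 => v ->.
Qed.

Lemma generically_definable (P : seq F -> Prop) : definable P ->
  generically (fun v => P (env_of v)) \/ generically (fun v => ~ P (env_of v)).
Proof.
move=> [phi hphi].
pose psi := GRing.quantifier_elim (@ClosedFieldQE.ex_elim F)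
  (GRing.to_rform phi).
have rphi := GRing.to_rform_rformula phi.
have /andP[qpsi rpsi] : GRing.qf_form psi && GRing.rformula psi.
  exact: (GRing.quantifier_elim_wf (@ClosedFieldQE.wf_ex_elim F)).
have psiP v : reflect (P (env_of v)) (GRing.qf_eval (env_of v) psi).
  have h := GRing.quantifier_elim_rformP (@ClosedFieldQE.wf_ex_elim F)
    (ClosedFieldQE.holds_ex_elim (@solve_monicpoly F)) (env_of v) rphi.
  apply: (iffP h).
    by move=> /GRing.to_rformP /hphi.
  by move=> Pv; apply/GRing.to_rformP/hphi.
case: (generically_qf qpsi rpsi) => g; [left|right];
  by apply: generically_imp g => v /psiP.
Qed.

End Generic.
End Definable.

(** * Nonvanishing of multivariate polynomials on infinite boxes *)

Lemma injective_notin_seq (T : eqType) (h : nat -> T) (s : seq T) :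
  injective h -> exists j, h j \notin s.
Proof.
move=> injh; apply: contrapT => no.
have /uniq_leq_size : {subset [seq h j | j <- iota 0 (size s).+1] <= s}.
  move=> _ /mapP[j _ ->]; apply: contrapT => /negP hs; apply: no.
  by exists j.
rewrite map_inj_uniq// iota_uniq size_map size_iota.
by rewrite ltnn => /(_ isT).
Qed.

Section Zariski.
Variable F : idomainType.

Lemma poly_nonroot_in (S : F -> Prop) (p : {poly F}) :
  (forall s : seq F, exists2 c, S c & c \notin s) -> p != 0 ->
  exists2 c, S c & ~~ root p c.
Proof.
move=> infS p0; apply: contrapT => noc.
have Sroot c : S c -> root p c.
  by move=> Sc; apply: contrapT => /negP nr; apply: noc; exists c.
(* If all elements of S were roots of p, S would provide size p distinct roots,
   one more than the degree allows. *)
suff [s [us ss rs]] : exists s : seq F,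
    [/\ uniq s, size s = size p & all (root p) s].
  by have := max_poly_roots p0 rs us; rewrite ss ltnn.
elim: (size p) => [|j [s [us <- rs]]]; first by exists [::].
have [c /Sroot rc cs] := infS s.
by exists (c :: s); rewrite /= cs us rc rs.
Qed.

(** A nonzero polynomial does not vanish on the whole of a product of infinite
    sets; infinite is stated as not being contained in any finite list.  The
    last variable is treated apart: some coefficient of p, seen as a polynomial
    in it, does not vanish at a point v of the product of the other sets, and
    the univariate polynomial obtained at v has finitely many roots. *)
Lemma mpoly_nonroot_in (N : nat) (S : 'I_N -> F -> Prop) (p : {mpoly F[N]}) :
  (forall i (s : seq F), exists2 c, S i c & c \notin s) -> p != 0 ->
  exists2 v : 'I_N -> F, (forall i, S i (v i)) & p.@[v] != 0.
Proof.
elim: N => [|N IHN] in S p *.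
  move=> _ p0; exists (fun _ => 0) => [[]//|].
  have ep : p = (p@_0)%:MP.
    apply/mpolyP => m; rewrite mcoeffC; suff -> : m = 0%MM by rewrite eqxx mulr1.
    by apply/mnmP => -[].
  by move: p0; rewrite ep mevalC mpolyC_eq0.
move=> infS p0.
pose w (i : 'I_N) : 'I_N.+1 := widen_ord (leqnSn N) i.
have [m mp] : exists m, m \in msupp p.
  case E: (msupp p) => [|m s]; last by exists m; rewrite inE eqxx.
  by move: p0; rewrite -msupp_eq0 E.
(* Distinct monomials with the same degree in the last variable stay distinct
   after deletion of this variable, so that p@_m survives in the coefficient. *)
have coefN0 : (muni p)`_(m ord_max) != 0.
  apply/eqP => /(congr1 (mcoeff [multinom m (w i) | i < N])) /eqP.
  rewrite mcoeff0 muniE coef_sum raddf_sum (bigD1_seq m)//= big1 => [|m' m'm].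
    rewrite !coefZ coefXn eqxx mulr1 mcoeffZ mcoeffX eqxx mulr1 addr0.
    by rewrite mcoeff_eq0 mp.
  rewrite coefZ coefXn; case: eqP => [emax|_]; last by rewrite mulr0 mcoeff0.
  rewrite mulr1 mcoeffZ mcoeffX; case: eqP => [ew|_]; last by rewrite mulr0.
  case/eqP: m'm; apply/mnmP => i; have [j ->|->//] := unliftP ord_max i.
  have -> : lift ord_max j = w j by apply/val_inj; rewrite /= /bump leqNgt ltn_ord.
  by have := congr1 (fun a : 'X_{1..N} => a j) ew; rewrite !mnmE.
have [v Sv pv] := IHN (S \o w) _ (fun i => infS (w i)) coefN0.
pose P := map_poly (meval v) (muni p).
have P0 : P != 0.
  by apply: contra_neq pv => P0; rewrite -[LHS](coef_map (meval v)) -/P P0 coef0.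
have [c Sc cP] : exists2 c, S ord_max c & ~~ root P c.
  exact: poly_nonroot_in.
exists (fun i => if unlift ord_max i is Some j then v j else c) => [i|].
  have [j ->|->] := unliftP ord_max i => //.
  have -> : lift ord_max j = w j by apply/val_inj; rewrite /= /bump leqNgt ltn_ord.
  exact: Sv.
suff -> : p.@[fun i => if unlift ord_max i is Some j then v j else c] = P.[c] by [].
rewrite /P muniE raddf_sum /= horner_sum mevalE; apply: eq_bigr => a _.
rewrite big_ord_recr/= unlift_none map_polyZ map_polyXn hornerZ hornerXn.
rewrite /= -mul_mpolyC mevalM mevalC mevalX -mulrA; congr (_ * (_ * _)).
apply: eq_bigr => j _; rewrite mnmE.
have -> : widen_ord (leqnSn N) j = lift ord_max j.
  by apply/val_inj; rewrite /= /bump leqNgt ltn_ord.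
by rewrite liftK.
Qed.

End Zariski.

(** * The l1 norm and strict differentiability of polynomials *)

Section Norm.
Variable R : realType.
Local Notation C := R[i].

Lemma normc_ge0 (z : C) : 0 <= nc z.
Proof. by case: z => a b; exact: sqrtr_ge0. Qed.

Lemma normc_sum (I : Type) (r : seq I) (P : pred I) (u : I -> C) :
  nc (\sum_(i <- r | P i) u i) <= \sum_(i <- r | P i) nc (u i).
Proof.
elim/big_ind2: _ => //; first by rewrite Normc.normc0.
by move=> a1 b1 a2 b2 h1 h2; apply: le_trans (le_normcD _ _) (lerD h1 h2).
Qed.

Lemma normc_real (a : R) : nc a%:C%C = `|a|.
Proof. by rewrite /= expr0n /= addr0 sqrtr_sqr. Qed.

(** The l1 norm of a complex row vector, with values in R. *)
Definition l1 (N : nat) (x : 'rV[C]_N) : R := \sum_j nc (x ord0 j).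

Lemma l1_ge0 N (x : 'rV[C]_N) : 0 <= l1 x.
Proof. by apply: sumr_ge0 => j _; exact: normc_ge0. Qed.

Lemma l1_0 N : l1 (0 : 'rV[C]_N) = 0.
Proof. by rewrite /l1 big1// => j _; rewrite mxE Normc.normc0. Qed.

Lemma l1D N (x y : 'rV[C]_N) : l1 (x + y) <= l1 x + l1 y.
Proof. by rewrite -big_split/= ler_sum// => j _; rewrite mxE le_normcD. Qed.

Lemma l1N N (x : 'rV[C]_N) : l1 (- x) = l1 x.
Proof. by apply: eq_bigr => j _; rewrite mxE normcN. Qed.

Lemma l1B N (x y : 'rV[C]_N) : l1 (x - y) = l1 (y - x).
Proof. by rewrite -l1N opprB. Qed.

Lemma l1_triangle N (x y z : 'rV[C]_N) : l1 (x - z) <= l1 (x - y) + l1 (y - z).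
Proof. by rewrite (_ : x - z = (x - y) + (y - z)) ?l1D// addrA subrK. Qed.

Lemma normc_le_l1 N (x : 'rV[C]_N) j : nc (x ord0 j) <= l1 x.
Proof.
by rewrite /l1 (bigD1 j)//= lerDl sumr_ge0// => i _; exact: normc_ge0.
Qed.

Lemma l1_eq0 N (x : 'rV[C]_N) : l1 x <= 0 -> x = 0.
Proof.
move=> x0; apply/rowP => j; rewrite mxE; apply: Normc.eq0_normc.
by apply/eqP; rewrite eq_le normc_ge0 (le_trans (normc_le_l1 x j)).
Qed.

Lemma l1_row_mx n k (x : 'rV[C]_n) (q : 'rV[C]_k) :
  l1 (row_mx x q) = l1 x + l1 q.
Proof.
rewrite /l1 big_split_ord/=; congr (_ + _); apply: eq_bigr => j _.
  by rewrite row_mxEl.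
by rewrite row_mxEr.
Qed.

Lemma l1_mulmx m n (B : 'M[C]_(m, n)) :
  exists2 b, 0 < b & forall x, l1 (x *m B) <= b * l1 x.
Proof.
pose b := \sum_j \sum_i nc (B i j).
have b0 : 0 <= b by do 2!apply: sumr_ge0 => ? _; exact: normc_ge0.
exists (b + 1) => [|x]; first by rewrite ltr_wpDl.
apply: (@le_trans _ _ (b * l1 x)); last by rewrite ler_wpM2r ?l1_ge0 ?lerDl.
rewrite /b mulr_suml ler_sum// => j _; rewrite mxE.
apply: le_trans (normc_sum _ _ _) _; rewrite mulr_suml ler_sum// => i _.
by rewrite Normc.normcM mulrC ler_wpM2l ?normc_ge0 ?normc_le_l1.
Qed.

(** Finitely many conditions, each valid for all small enough radii, share a
    common radius. *)
Lemma uniform_pos (I : finType) (P : I -> R -> Prop) :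
  (forall i d e, e <= d -> P i d -> P i e) ->
  (forall i, exists2 d, 0 < d & P i d) -> exists2 d, 0 < d & forall i, P i d.
Proof.
move=> mono exd.
suff [d d0 h] : exists2 d, 0 < d & forall i, i \in enum I -> P i d.
  by exists d => // i; apply: h; rewrite mem_enum.
elim: (enum I) => [|i s [d d0 h]]; first by exists 1.
have [e e0 he] := exd i; exists (Num.min d e); first by rewrite lt_min d0.
move=> j; rewrite inE => /orP[/eqP->|/h].
  by apply: mono he; rewrite ge_min lexx orbT.
by apply: mono; rewrite ge_min lexx.
Qed.

Section StrictDiff.
Variables (N : nat) (z : 'rV[C]_N).

(** The differential of p at z, as a linear form in the increment h. *)
Definition differential (p : {mpoly C[N]}) (h : 'rV[C]_N) : C :=
  \sum_j p^`M(j).@[z ord0] * h ord0 j.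

(** Strict differentiability of p at z: the linear approximation of
    p(x) - p(y) has an error that is small relatively to |x - y|, uniformly in
    both points x and y near z. *)
Definition strict_diff (p : {mpoly C[N]}) : Prop :=
  forall e, 0 < e -> exists2 d, 0 < d & forall x y : 'rV[C]_N,
    l1 (x - z) < d -> l1 (y - z) < d ->
    nc (p.@[x ord0] - p.@[y ord0] - differential p (x - y)) <= e * l1 (x - y).

Lemma differential_le p :
  exists2 b, 0 < b & forall h, nc (differential p h) <= b * l1 h.
Proof.
pose b := \sum_j nc (p^`M(j).@[z ord0]).
have b0 : 0 <= b by apply: sumr_ge0 => ? _; exact: normc_ge0.
exists (b + 1) => [|h]; first by rewrite ltr_wpDl.
apply: (@le_trans _ _ (b * l1 h)); last by rewrite ler_wpM2r ?l1_ge0 ?lerDl.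
apply: le_trans (normc_sum _ _ _) _; rewrite /b mulr_suml ler_sum// => i _.
by rewrite Normc.normcM ler_wpM2l ?normc_ge0 ?normc_le_l1.
Qed.

Lemma strict_diff_lipschitz p : strict_diff p ->
  exists L d : R, [/\ 0 < L, 0 < d & forall x y : 'rV[C]_N,
    l1 (x - z) < d -> l1 (y - z) < d ->
    nc (p.@[x ord0] - p.@[y ord0]) <= L * l1 (x - y)].
Proof.
move=> /(_ 1 ltr01)[d d0 hd]; have [b b0 hb] := differential_le p.
exists (1 + b), d; split=> // [|x y xd yd]; first by rewrite addr_gt0.
rewrite -[X in nc X](subrK (differential p (x - y))) mulrDl.
by apply: le_trans (le_normcD _ _) (lerD (hd _ _ xd yd) (hb _)).
Qed.

Lemma strict_diff_continuous p : strict_diff p -> forall e, 0 < e ->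
  exists2 d, 0 < d & forall x : 'rV[C]_N,
    l1 (x - z) < d -> nc (p.@[x ord0] - p.@[z ord0]) < e.
Proof.
move=> /strict_diff_lipschitz[L [d [L0 d0 hL]]] e e0.
exists (Num.min d (e / L)); first by rewrite lt_min d0 divr_gt0.
move=> x; rewrite lt_min ltr_pdivlMr// => /andP[xd xe].
apply: le_lt_trans (hL x z xd _) _; first by rewrite subrr l1_0.
by rewrite mulrC.
Qed.

Lemma strict_diffC c : strict_diff c%:MP.
Proof.
move=> e e0; exists 1 => // x y _ _.
rewrite !mevalC subrr /differential big1 => [|j _]; last by rewrite mderivC meval0 mul0r.
by rewrite subr0 Normc.normc0 mulr_ge0 ?l1_ge0 ?ltW.
Qed.

Lemma strict_diffX i : strict_diff 'X_i.
Proof.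
move=> e e0; exists 1 => // x y _ _.
rewrite !mevalXU /differential (bigD1 i)//= big1 => [|j ji].
  rewrite mderivX mevalZ mevalX mnm1E eqxx mul1r.
  rewrite big1 => [|l _]; last by rewrite mnmE subnn expr0.
  by rewrite mul1r !mxE addr0 subrr Normc.normc0 mulr_ge0 ?l1_ge0 ?ltW.
by rewrite mderivX mevalZ mnm1E eq_sym (negbTE ji) !mul0r.
Qed.

Lemma strict_diffD p q : strict_diff p -> strict_diff q -> strict_diff (p + q).
Proof.
move=> hp hq e e0; have e2 : 0 < e / 2 by rewrite divr_gt0.
have [d1 d10 h1] := hp _ e2; have [d2 d20 h2] := hq _ e2.
exists (Num.min d1 d2); first by rewrite lt_min d10.
move=> x y; rewrite !lt_min => /andP[x1 x2] /andP[y1 y2].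
have -> : differential (p + q) (x - y) =
    differential p (x - y) + differential q (x - y).
  rewrite -big_split/=; apply: eq_bigr => j _.
  by rewrite mderivD mevalD mulrDl.
rewrite [e in e * _]splitr mulrDl !mevalD [X in nc X](_ : _ =
  (p.@[x ord0] - p.@[y ord0] - differential p (x - y)) +
  (q.@[x ord0] - q.@[y ord0] - differential q (x - y))).
  exact: le_trans (le_normcD _ _) (lerD (h1 _ _ x1 y1) (h2 _ _ x2 y2)).
by rewrite !opprD !addrA (ACl (1*3*5*2*4*6)).
Qed.

Lemma strict_diffM p q : strict_diff p -> strict_diff q -> strict_diff (p * q).
Proof.
move=> hp hq e e0.
have [bp bp0 hbp] := differential_le p; have [bq bq0 hbq] := differential_le q.
set p0 := p.@[z ord0]; set q0 := q.@[z ord0].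
pose K := (nc p0 + 1) + bq + (nc q0 + 1) + bp.
have np0 := normc_ge0 p0; have nq0 := normc_ge0 q0.
have K0 : 0 < K by rewrite /K; lra.
pose t := Num.min 1 (e / K).
have t0 : 0 < t by rewrite lt_min ltr01 divr_gt0.
have t1 : t <= 1 by rewrite ge_min lexx.
have tK : t * K <= e by rewrite -ler_pdivlMr// ge_min lexx orbT.
have [d1 d10 h1] := hp _ t0; have [d2 d20 h2] := hq _ t0.
have [d3 d30 h3] := strict_diff_continuous hp t0.
have [d4 d40 h4] := strict_diff_continuous hq t0.
exists (Num.min (Num.min d1 d2) (Num.min d3 d4)).
  by rewrite !lt_min d10 d20 d30.
move=> x y; rewrite !lt_min => /andP[/andP[x1 x2] /andP[x3 x4]].
move=> /andP[/andP[y1 y2] /andP[y3 y4]].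
have := h1 _ _ x1 y1; have := h2 _ _ x2 y2; have := h3 _ x3; have := h4 _ y4.
have := hbp (x - y); have := hbq (x - y).
have -> : differential (p * q) (x - y) =
    differential p (x - y) * q0 + p0 * differential q (x - y).
  rewrite mulr_suml mulr_sumr -big_split/=; apply: eq_bigr => j _.
  rewrite mderivM mevalD !mevalM mulrDl mulrAC.
  by rewrite [X in _ = _ + X]mulrA.
rewrite !mevalM -/p0 -/q0; set S := l1 _; have S0 : 0 <= S := l1_ge0 _.
move: (differential p _) (differential q _).
move: (p.@[x ord0]) (p.@[y ord0]) (q.@[x ord0]) (q.@[y ord0]).
move=> px py qx qy dp dq b1 b2 c4 c3 c2 c1.
(* The error splits into the errors for p and q, weighted by bounded values,
   and the variations of p and q near z, weighted by differentials. *)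
rewrite [X in nc X](_ : _ = px * (qx - qy - dq) + (px - p0) * dq +
   (qy * (px - py - dp) + (qy - q0) * dp)); last by ring.
have npx : nc px <= nc p0 + 1.
  rewrite -[px](subrK p0) addrC; apply: le_trans (le_normcD _ _) _.
  by rewrite lerD2l (le_trans (ltW c3)).
have nqy : nc qy <= nc q0 + 1.
  rewrite -[qy](subrK q0) addrC; apply: le_trans (le_normcD _ _) _.
  by rewrite lerD2l (le_trans (ltW c4)).
have M (a b : C) (u v : R) : nc a <= u -> nc b <= v -> nc (a * b) <= u * v.
  by move=> au bv; rewrite Normc.normcM ler_pM ?normc_ge0.
have D (a b : C) (u v : R) : nc a <= u -> nc b <= v -> nc (a + b) <= u + v.
  by move=> au bv; apply: le_trans (le_normcD _ _) (lerD au bv).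
apply: (@le_trans _ _ (((nc p0 + 1) * (t * S) + t * (bq * S)) +
   ((nc q0 + 1) * (t * S) + t * (bp * S)))).
  by apply: (D); apply: (D); apply: M => //; exact: ltW.
rewrite (_ : _ + _ = t * K * S); last by rewrite /K; ring.
by rewrite ler_wpM2r.
Qed.

Lemma mpoly_strict_diff p : strict_diff p.
Proof.
have XnP m : strict_diff 'X_[m].
  rewrite mpolyXE_id; elim/big_ind: _ => [|a b|i _]; first exact: (strict_diffC 1).
    exact: strict_diffM.
  elim: (m i) => [|j IHj]; first by rewrite expr0; exact: (strict_diffC 1).
  by rewrite exprS; exact (strict_diffM (strict_diffX i) IHj).
elim/mpolyind: p => [|c m p _ _ IH]; first by rewrite -mpolyC0; exact: strict_diffC.
by rewrite -mul_mpolyC; exact (strict_diffD (strict_diffM (strict_diffC c) (XnP m)) IH).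
Qed.

End StrictDiff.
End Norm.

(** * Chord iteration *)

Section Newton.
Variable R : realType.
Local Notation C := R[i].

Lemma le0_geometric (a K : R) : 0 <= K ->
  (forall s : nat, a <= K * 2^-1 ^+ s) -> a <= 0.
Proof.
move=> K0 h; rewrite leNgt; apply/negP => a0.
have [s Ks] : exists s : nat, K < a * 2 ^+ s.
  exists (Num.truncn (K / a)).+1.
  rewrite mulrC -ltr_pdivrMr//; apply: (lt_trans (truncnS_gt _)).
  by rewrite -natrX ltr_nat ltn_expl.
by have := h s; rewrite exprVn ler_pdivlMr ?exprn_gt0// leNgt Ks.
Qed.

(** The sequences a_s - 2 K / 2^s and a_s + 2 K / 2^s are respectively
    nondecreasing and nonincreasing; the limit is the supremum of the former. *)
Lemma geometric_cvg_real (a : nat -> R) (K : R) : 0 <= K ->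
  (forall s, `|a s.+1 - a s| <= K * 2^-1 ^+ s) ->
  exists l, forall s, `|a s - l| <= 2 * K * 2^-1 ^+ s.
Proof.
move=> K0 ha; pose r s : R := 2 * K * 2^-1 ^+ s.
have r0 s : 0 <= r s by rewrite !mulr_ge0// exprn_ge0// invr_ge0.
have rS s : r s - r s.+1 = K * 2^-1 ^+ s.
  rewrite /r exprS mulrCA mulrA [2^-1 * _]mulrA mulVf ?pnatr_eq0// mul1r.
  by rewrite -[2 * K * _]mulrA mulr2n mulrDl mul1r addrK.
have up : {homo (fun s => a s - r s) : s t / (s <= t)%N >-> s <= t}.
  apply: homo_leq => [//|? ? ?|s]; first exact: le_trans.
  by have := ha s; rewrite -rS ler_norml => /andP[]; lra.
have dn : {homo (fun s => - (a s + r s)) : s t / (s <= t)%N >-> s <= t}.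
  apply: homo_leq => [//|? ? ?|s]; first exact: le_trans.
  by have := ha s; rewrite -rS ler_norml => /andP[]; lra.
pose E : set R := range (fun s => a s - r s)%classic.
have ubE t : ubound E (a t + r t).
  move=> _ [s _ <-]; have := up _ _ (leq_maxl s t); have := dn _ _ (leq_maxr s t).
  by have := r0 (maxn s t); lra.
have E0 : (E !=set0)%classic by exists (a 0%N - r 0%N), 0%N.
exists (sup E) => s; rewrite -/(r s) ler_norml.
have := ge_sup E0 (ubE s).
have : a s - r s <= sup E.
  by apply: sup_upper_bound; [split => //; exists (a 0%N + r 0%N) | exists s].
by move=> h1 h2; apply/andP; split; lra.
Qed.

Lemma normc_Re_Im (z : C) :
  [/\ `|complex.Re z| <= nc z, `|complex.Im z| <= nc z &
      nc z <= `|complex.Re z| + `|complex.Im z|].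
Proof.
case: z => a b /=; split.
- by rewrite -sqrtr_sqr ler_wsqrtr// lerDl sqr_ge0.
- by rewrite -sqrtr_sqr ler_wsqrtr// lerDr sqr_ge0.
rewrite -[leRHS]ger0_norm ?addr_ge0// -sqrtr_sqr ler_wsqrtr//.
by rewrite sqrrD !real_normK ?num_real// lerD2r lerDl mulrn_wge0// mulr_ge0.
Qed.

Lemma geometric_cvg (u : nat -> C) (K : R) : 0 <= K ->
  (forall s, nc (u s.+1 - u s) <= K * 2^-1 ^+ s) ->
  exists l, forall s, nc (u s - l) <= 4 * K * 2^-1 ^+ s.
Proof.
move=> K0 hu.
have [a ha] : exists l, forall s, `|complex.Re (u s) - l| <= 2 * K * 2^-1 ^+ s.
  apply: geometric_cvg_real => // s; apply: le_trans (hu s).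
  by rewrite -raddfB; case: (normc_Re_Im (u s.+1 - u s)).
have [b hb] : exists l, forall s, `|complex.Im (u s) - l| <= 2 * K * 2^-1 ^+ s.
  apply: geometric_cvg_real => // s; apply: le_trans (hu s).
  by rewrite -raddfB; case: (normc_Re_Im (u s.+1 - u s)).
exists (a +i* b)%C => s; case: (normc_Re_Im (u s - (a +i* b)%C)) => _ _ h.
apply: le_trans h _; rewrite !raddfB/=.
by have := ha s; have := hb s; lra.
Qed.

Lemma geometric_cvg_row N (u : nat -> 'rV[C]_N) (K : R) : 0 <= K ->
  (forall s, l1 (u s.+1 - u s) <= K * 2^-1 ^+ s) ->
  exists l, exists2 K', 0 <= K' & forall s, l1 (u s - l) <= K' * 2^-1 ^+ s.
Proof.
move=> K0 hu.
have /choice[l hl] : forall j, exists c, forall s,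
    nc (u s ord0 j - c) <= 4 * K * 2^-1 ^+ s.
  move=> j; apply: geometric_cvg => // s; apply: le_trans (hu s).
  by apply: le_trans (normc_le_l1 _ j); rewrite !mxE.
exists (\row_j l j), (\sum_(j < N) 4 * K).
  by rewrite sumr_ge0// => _ _; rewrite mulr_ge0.
by move=> s; rewrite mulr_suml ler_sum// => j _; rewrite !mxE.
Qed.

(** If F is, on the ball of radius rho around x0, a perturbation of the
    invertible linear map J with a small relative error, and if F x0 is small,
    then x - F x *m J^-1 is a contraction of factor 1/2 whose iterates from x0
    stay in the ball; their limit is a zero of F. *)
Lemma newton N (F : 'rV[C]_N -> 'rV[C]_N) (x0 : 'rV[C]_N) (J B : 'M[C]_N)
    (b e rho : R) :
  0 < b -> 0 <= e -> 0 <= rho ->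
  B *m J = 1%:M -> J *m B = 1%:M ->
  (forall v : 'rV[C]_N, l1 (v *m B) <= b * l1 v) ->
  (forall x y, l1 (x - x0) <= rho -> l1 (y - x0) <= rho ->
     l1 (F x - F y - (x - y) *m J) <= e * l1 (x - y)) ->
  b * e <= 2^-1 -> b * l1 (F x0) <= rho / 2 ->
  exists2 x, l1 (x - x0) <= rho & F x = 0.
Proof.
move=> b0 e0 rho0 BJ JB hB hF be Fx0.
pose T x := x - F x *m B.
have TE x y : T x - T y = - ((F x - F y - (x - y) *m J) *m B).
  rewrite mulmxBl mulmxBl -mulmxA JB mulmx1 /T !opprB !addrA.
  by rewrite (ACl (1*4*3*2)).
have hT x y : l1 (x - x0) <= rho -> l1 (y - x0) <= rho ->
    l1 (T x - T y) <= 2^-1 * l1 (x - y).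
  move=> xr yr; rewrite TE l1N; apply: le_trans (hB _) _.
  apply: (@le_trans _ _ (b * (e * l1 (x - y)))).
    by rewrite ler_pM2l// hF.
  by rewrite mulrA ler_wpM2r ?l1_ge0.
have Tsub x : T x - x = - (F x *m B) by rewrite addrC addKr.
pose u s := iter s T x0.
have u_step s : l1 (u s - x0) <= rho * (1 - 2^-1 ^+ s) /\
    l1 (u s.+1 - u s) <= rho / 2 * 2^-1 ^+ s.
  elim: s => [|s [IH1 IH2]].
    rewrite !expr0 !subrr mulr0 mulr1 l1_0; split => //.
    rewrite Tsub l1N; exact: le_trans (hB _) Fx0.
  have in_ball (t : R) : 0 <= t -> rho * (1 - t) <= rho.
    by move=> t0; rewrite ler_piMr// gerBl.
  have h1 : l1 (u s.+1 - x0) <= rho * (1 - 2^-1 ^+ s.+1).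
    apply: le_trans (l1_triangle _ (u s) _) _.
    apply: le_trans (lerD IH2 IH1) _; rewrite exprS; lra.
  split=> //; apply: le_trans (hT _ _ _ _) _.
  - by apply: le_trans h1 _; rewrite in_ball ?exprn_ge0 ?invr_ge0.
  - by apply: le_trans IH1 _; rewrite in_ball ?exprn_ge0 ?invr_ge0.
  by rewrite exprS; lra.
have rho2 : 0 <= rho / 2 by rewrite divr_ge0.
have [x [K K0 hx]] := geometric_cvg_row rho2 (fun s => (u_step s).2).
have u_ball s : l1 (u s - x0) <= rho.
  case: (u_step s) => h _; apply: le_trans h _.
  by rewrite ler_piMr// gerBl exprn_ge0 ?invr_ge0.
have x_ball : l1 (x - x0) <= rho.
  rewrite -subr_le0; apply: (@le0_geometric _ K) => // s.
  rewrite lerBlDr; apply: le_trans (l1_triangle _ (u s) _) _.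
  by rewrite lerD// l1B.
exists x => //.
have Tx : T x - x = 0.
  apply: l1_eq0; apply: (@le0_geometric _ K) => // s.
  apply: le_trans (l1_triangle _ (u s.+1) _) _.
  apply: le_trans (lerD (hT _ (u s) x_ball (u_ball s)) (hx s.+1)) _.
  by have := hx s; rewrite l1B exprS; lra.
have FB : F x *m B = 0.
  by move/eqP: Tx; rewrite Tsub oppr_eq0 => /eqP.
by rewrite -[F x]mulmx1 -BJ mulmxA FB mul0mx.
Qed.

End Newton.

(** * Persistence of regular zeros under perturbation *)

Section Persistence.
Variables (R : realType) (n k : nat).
Local Notation C := R[i].
Implicit Types (p g : {mpoly C[n + k]}) (x y : 'rV[C]_n) (q : 'rV[C]_k) (t : C).

Lemma eval_at_perturb p g t x q :
  eval_at (p + t *: g) x q = eval_at p x q + t * eval_at g x q.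
Proof. by rewrite /eval_at mevalD mevalZ. Qed.

Lemma row_mx_near x x0 q q0 (d : R) : l1 (x - x0) < d / 2 ->
  l1 (q - q0) < d / 2 ->
  l1 (row_mx x q - row_mx x0 q0) < d.
Proof.
move=> hx hq; rewrite opp_row_mx add_row_mx l1_row_mx [d]splitr; exact: ltrD.
Qed.

(** The difference of two values of p + t g at the same parameter q is
    approximated by the partial differential of p at (x0, q0) in the
    variables. *)
Lemma perturb_strict_diff p g x0 q0 (e : R) : 0 < e ->
  exists2 d, 0 < d & forall x y q t,
    l1 (x - x0) < d -> l1 (y - x0) < d -> l1 (q - q0) < d -> nc t < d ->
    nc (eval_at (p + t *: g) x q - eval_at (p + t *: g) y q -
        \sum_j eval_at p^`M(lshift k j) x0 q0 * (x - y) ord0 j)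
      <= e * l1 (x - y).
Proof.
move=> e0; have e2 : 0 < e / 2 by rewrite divr_gt0.
have [d1 d10 h1] := mpoly_strict_diff (row_mx x0 q0) p e2.
have [L [d2 [L0 d20 h2]]] := strict_diff_lipschitz (mpoly_strict_diff (row_mx x0 q0) g).
have e2L : 0 < e / 2 / L by rewrite divr_gt0.
exists (Num.min (Num.min (d1 / 2) (d2 / 2)) (e / 2 / L)).
  by rewrite !lt_min !divr_gt0.
move=> x y q t; rewrite !lt_min => /andP[/andP[x1 x2] _] /andP[/andP[y1 y2] _].
move=> /andP[/andP[q1 q2] _] /andP[_ ht].
have := h1 _ _ (row_mx_near x1 q1) (row_mx_near y1 q1).
have := h2 _ _ (row_mx_near x2 q2) (row_mx_near y2 q2).
have -> : row_mx x q - row_mx y q = row_mx (x - y) 0.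
  by rewrite opp_row_mx add_row_mx subrr.
rewrite l1_row_mx l1_0 addr0 /differential big_split_ord/=.
rewrite [X in _ - _ - (_ + X)]big1 ?addr0 => [hg|j _]; last by rewrite row_mxEr mxE mulr0.
under eq_bigr do rewrite row_mxEl.
rewrite !eval_at_perturb -/(eval_at p x q) -/(eval_at p y q) => hp.
set S := (X in _ - _ - X); set S' := (X in _ - _ - X) in hp.
have -> : S = S' by [].
have -> : eval_at p x q + t * eval_at g x q - (eval_at p y q + t * eval_at g y q) - S'
  = (eval_at p x q - eval_at p y q - S') + t * (eval_at g x q - eval_at g y q).
  by rewrite mulrBr opprD !addrA (ACl (1*3*5*2*4)).
apply: le_trans (le_normcD _ _) _; rewrite [e]splitr mulrDl; apply: lerD => //.
rewrite Normc.normcM; apply: (@le_trans _ _ (e / 2 / L * (L * l1 (x - y)))).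
  by apply: ler_pM; rewrite ?normc_ge0// ltW.
by rewrite mulrA divfK ?gt_eqF.
Qed.

Lemma perturb_small p g x0 q0 (c : R) : eval_at p x0 q0 = 0 -> 0 < c ->
  exists2 d, 0 < d & forall q t,
    l1 (q - q0) < d -> nc t < d -> nc (eval_at (p + t *: g) x0 q) <= c.
Proof.
move=> p0 c0; have c2 : 0 < c / 2 by rewrite divr_gt0.
have [d1 d10 h1] := strict_diff_continuous (mpoly_strict_diff (row_mx x0 q0) p) c2.
have [d2 d20 h2] := strict_diff_continuous (mpoly_strict_diff (row_mx x0 q0) g) ltr01.
pose M := nc (eval_at g x0 q0) + 1.
have M0 : 0 < M by rewrite ltr_wpDl ?normc_ge0.
exists (Num.min (Num.min (d1 / 2) (d2 / 2)) (c / 2 / M)).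
  by rewrite !lt_min !divr_gt0.
move=> q t; rewrite !lt_min => /andP[/andP[q1 q2] _] /andP[_ ht].
have xx (d : R) : 0 < d -> l1 (x0 - x0) < d / 2 by rewrite subrr l1_0 => /divr_gt0->.
have := h1 _ (row_mx_near (xx _ d10) q1); have := h2 _ (row_mx_near (xx _ d20) q2).
rewrite -!/(eval_at _ _ _) p0 subr0 => hg hp.
rewrite eval_at_perturb; apply: le_trans (le_normcD _ _) _.
rewrite [c]splitr; apply: lerD; first exact: ltW.
rewrite Normc.normcM; apply: (@le_trans _ _ (c / 2 / M * M)).
  apply: ler_pM; rewrite ?normc_ge0 ?(ltW ht)//.
  rewrite -[eval_at g x0 q](subrK (eval_at g x0 q0)) /M addrC.
  apply: le_trans (le_normcD _ _) _; rewrite lerD2l; exact: ltW.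
by rewrite divfK ?gt_eqF.
Qed.

(** The Jacobian determinant of f in the variables, as a polynomial in the
    variables and the parameters. *)
Definition jac_poly (f : 'I_n -> {mpoly C[n + k]}) : {mpoly C[n + k]} :=
  \det (\matrix_(i, j) (f i)^`M(lshift k j)).

Lemma eval_jac_poly f x q : eval_at (jac_poly f) x q = \det (jacobian f x q).
Proof.
rewrite /eval_at /jac_poly -det_map_mx; congr (\det _).
by apply/matrixP => i j; rewrite !mxE.
Qed.

(** The conclusion on the Jacobian is about f itself, not about f + t g; for
    t = 0 it says that the zero found is a regular zero of f at q. *)
Lemma regular_zero_persists (f g : 'I_n -> {mpoly C[n + k]}) q0 x0 (eta : R) :
  is_regular_zero f q0 x0 -> 0 < eta ->
  exists2 d, 0 < d & forall t q, nc t < d -> l1 (q - q0) < d ->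
    exists x, [/\ l1 (x - x0) <= eta,
      forall i, eval_at (f i + t *: g i) x q = 0 &
      \det (jacobian f x q) <> 0].
Proof.
move=> [fx0 detJ] eta0.
pose J := (jacobian f x0 q0)^T; pose B := invmx J.
have uJ : J \in unitmx by rewrite unitmxE det_tr unitfE; apply/eqP.
have [b b0 hB] := l1_mulmx B.
pose e := (2 * b * n.+1%:R)^-1.
have e0 : 0 < e by rewrite invr_gt0 !mulr_gt0.
have [d1 d10 h1] := uniform_pos (I := 'I_n) (P := fun i d => forall x y q t,
    l1 (x - x0) < d -> l1 (y - x0) < d -> l1 (q - q0) < d -> nc t < d ->
    nc (eval_at (f i + t *: g i) x q - eval_at (f i + t *: g i) y q -
        \sum_j eval_at (f i)^`M(lshift k j) x0 q0 * (x - y) ord0 j)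
      <= e * l1 (x - y))
  (fun i d d' dd' H x y q t h1 h2 h3 h4 => H x y q t (lt_le_trans h1 dd')
    (lt_le_trans h2 dd') (lt_le_trans h3 dd') (lt_le_trans h4 dd'))
  (fun i => perturb_strict_diff (f i) (g i) x0 q0 e0).
have njac : 0 < nc (eval_at (jac_poly f) x0 q0).
  rewrite lt_neqAle normc_ge0 andbT eq_sym; apply/eqP => /Normc.eq0_normc.
  by rewrite eval_jac_poly.
have [d2 d20 h2] := strict_diff_continuous (mpoly_strict_diff (row_mx x0 q0) (jac_poly f)) njac.
(* Within rho of x0 the linear approximation holds, and the Jacobian
   determinant does not vanish. *)
pose rho := Num.min eta (Num.min (d1 / 2) (d2 / 4)).
have rho0 : 0 < rho by rewrite !lt_min eta0 !divr_gt0.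
have rho1 : rho < d1.
  by apply: (@le_lt_trans _ _ (d1 / 2)); [rewrite !ge_min lexx !orbT | lra].
have rho2 : rho < d2 / 2.
  by apply: (@le_lt_trans _ _ (d2 / 4)); [rewrite !ge_min lexx !orbT | lra].
pose c := rho / 2 / b / n.+1%:R.
have c0 : 0 < c by rewrite !divr_gt0.
have [d3 d30 h3] := uniform_pos (I := 'I_n) (P := fun i d => forall q t,
    l1 (q - q0) < d -> nc t < d -> nc (eval_at (f i + t *: g i) x0 q) <= c)
  (fun i d d' dd' H q t h1 h2 => H q t (lt_le_trans h1 dd') (lt_le_trans h2 dd'))
  (fun i => perturb_small (g i) (fx0 i) c0).
have le_n (a : R) : 0 <= a -> \sum_(i < n) a <= n.+1%:R * a.
  move=> a0; rewrite sumr_const card_ord -[a *+ n]mulr_natl ler_wpM2r// ler_nat.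
  exact: leqnSn.
exists (Num.min (Num.min d1 (d2 / 2)) d3); first by rewrite !lt_min d10 d30 divr_gt0.
move=> t q; rewrite !lt_min => /andP[/andP[t1 t2] t3] /andP[/andP[q1 q2] q3].
pose F (x : 'rV[C]_n) := \row_i eval_at (f i + t *: g i) x q.
have [|||||x y xr yr|||x xrho Fx0] := @newton R n F x0 J B b (e * n.+1%:R) rho b0.
- by rewrite mulr_ge0 ?ltW.
- exact: ltW.
- exact: mulVmx.
- exact: mulmxV.
- exact: hB.
- apply: (@le_trans _ _ (\sum_(i < n) (e * l1 (x - y)))).
    apply: ler_sum => i _.
    have := h1 i x y q t (le_lt_trans xr rho1) (le_lt_trans yr rho1) q1 t1.
    congr (nc _ <= _); rewrite /F !mxE; congr (_ - _).
    by apply: eq_bigr => j _; rewrite /J !mxE mulrC.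
  rewrite [e * _ * _]mulrAC [X in _ <= X]mulrC.
  by apply: le_n; rewrite mulr_ge0 ?l1_ge0 ?ltW.
- rewrite mulrCA /e -[2 * b * _]mulrA invfM -mulrA mulVf ?mulr1//.
  by rewrite mulf_neq0 ?gt_eqF.
- rewrite -ler_pdivlMl// mulrC; apply: (@le_trans _ _ (\sum_(i < n) c)).
    apply: ler_sum => i _. by rewrite /F mxE h3.
  apply: le_trans (le_n _ (ltW c0)) _.
  by rewrite [leLHS]mulrC /c divfK ?pnatr_eq0.
exists x; split.
- by apply: le_trans xrho _; rewrite ge_min lexx.
- by move=> i; move/rowP: Fx0 => /(_ i); rewrite !mxE.
rewrite -eval_jac_poly => jx0.
have := h2 _ (row_mx_near (le_lt_trans xrho rho2) q2).
by rewrite -!/(eval_at _ _ _) jx0 sub0r normcN ltxx.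
Qed.

End Persistence.

(** * A uniform bound on the number of zeros *)

Section Bezout.
Variables (R : realType) (n k m d : nat).
Local Notation C := R[i].
Variables (f : 'I_n -> {mpoly C[n + k]}) (t : C) (q : 'rV[C]_k).
Variable Z : 'I_m -> 'rV[C]_n.
Hypothesis t0 : t != 0.
Hypothesis f_deg : forall i, (msize (f i) <= d.+1)%N.
Hypothesis Z0 : forall b i,
  eval_at (f i + t *: 'X_(lshift k i) ^+ d.+1) (Z b) q = 0.

(** The values of p at the points Z b, for the parameter q. *)
Definition eval_row (p : {mpoly C[n + k]}) : 'rV[C]_m :=
  \row_b eval_at p (Z b) q.

(** The matrix whose rows are the values at the points Z b of the monomials in
    the variables with all exponents at most d; its rows are indexed by the
    (d+1)^n possible exponents. *)
Definition reduced_monomials : 'M[C]_(#|{ffun 'I_n -> 'I_d.+1}|, m) :=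
  \matrix_(r, b) \prod_i Z b ord0 i ^+ (enum_val r : {ffun 'I_n -> 'I_d.+1}) i.

Local Notation W := reduced_monomials.

Lemma eval_row_mpoly (p : {mpoly C[n + k]}) :
  eval_row p = \sum_(M <- msupp p) p@_M *: eval_row 'X_[M].
Proof.
apply/rowP => b; rewrite summxE !mxE /eval_at [in LHS](mpolyE p) raddf_sum/=.
by apply: eq_bigr => M _; rewrite mevalZ !mxE.
Qed.

(** On the points Z b the power x_i^(d+1) equals - f_i / t, whose degree is at
    most d: as long as some exponent exceeds d, this substitution lowers the
    total degree in all indeterminates. *)
Lemma eval_monomial_reduced (M : 'X_{1..n + k}) : (eval_row 'X_[M] <= W)%MS.
Proof.
have [D] := ubnP (mdeg M); elim: D => // D IHD in M *; rewrite ltnS => MD.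
have [/existsP[i Mi]|/existsPn Md] := boolP [exists i, d < M (lshift k i)]%N.
  pose U : 'X_{1..n + k} := (U_(lshift k i) *+ d.+1)%MM.
  pose M' := (M - U)%MM.
  have EM : M = (M' + U)%MM.
    rewrite submK//; apply/mnm_lepP => j; rewrite mulmnE mnm1E.
    by case: eqP => [<-|_]; rewrite ?mul1n ?mul0n.
  have -> : eval_row 'X_[M] = - t^-1 *: eval_row ('X_[M'] * f i).
    apply/rowP => b; rewrite !mxE EM mpolyXD /U -mpolyXn.
    have := Z0 b i; rewrite eval_at_perturb => /eqP.
    rewrite /eval_at !mevalM addrC addr_eq0 => /eqP e.
    rewrite -[X in _ * X = _](mulKf t0) e.
    by rewrite mulrN mulrN mulrCA mulNr.
  apply: scalemx_sub; rewrite (_ : eval_row _ = \sum_(N <- msupp (f i))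
      (f i)@_N *: eval_row 'X_[(M' + N)]); last first.
    apply/rowP => b; rewrite summxE !mxE /eval_at mevalM.
    rewrite [in LHS](mpolyE (f i)) raddf_sum mulr_sumr/=.
    by apply: eq_bigr => N _; rewrite mevalZ !mxE /eval_at mpolyXD mevalM mulrCA.
  rewrite big_seq; apply: summx_sub => N Nf; apply/scalemx_sub/IHD.
  have := msize_mdeg_lt Nf; have := f_deg i.
  move: MD; rewrite EM !mdegD /U mdegMn mdeg1 mul1n.
  lia.
pose r : {ffun 'I_n -> 'I_d.+1} := [ffun i => inord (M (lshift k i))].
have -> : eval_row 'X_[M] =
    (\prod_l q ord0 l ^+ M (rshift n l)) *: row (enum_rank r) W.
  apply/rowP => b; rewrite !mxE /eval_at mevalX big_split_ord mulrC/=.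
  congr (_ * _); apply: eq_bigr => i _; rewrite ?row_mxEl ?row_mxEr//.
  by rewrite enum_rankK ffunE inordK// ltnS leqNgt.
by rewrite scalemx_sub ?row_sub.
Qed.

Lemma eval_row_reduced (p : {mpoly C[n + k]}) : (eval_row p <= W)%MS.
Proof.
rewrite eval_row_mpoly; apply: summx_sub => M _.
exact/scalemx_sub/eval_monomial_reduced.
Qed.

Lemma nb_zeros_perturbed : (0 < n)%N -> injective Z -> (m <= d.+1 ^ n)%N.
Proof.
move=> n_gt0 injZ.
have sep b c : exists j, b != c -> Z b ord0 j != Z c ord0 j.
  have [->|bc] := eqVneq b c; first by exists (Ordinal n_gt0).
  have /existsP[j hj] : [exists j, Z b ord0 j != Z c ord0 j].
    apply: contraNT bc => /existsPn h; apply/eqP/injZ/rowP => j.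
    by apply/eqP; rewrite -[_ == _]negbK h.
  by exists j.
suff /mxrankS : (1%:M <= W)%MS.
  rewrite mxrank1 => /leq_trans; apply.
  by apply: leq_trans (rank_leq_row _) _; rewrite card_ffun !card_ord.
apply/row_subP => b; have /choice[j jP] := sep b.
(* The Lagrange interpolation polynomial that is 1 at Z b and 0 at the other
   points. *)
pose p := \prod_(c | c != b) ((Z b ord0 (j c) - Z c ord0 (j c))^-1 *:
  ('X_(lshift k (j c)) - (Z c ord0 (j c))%:MP)) : {mpoly C[n + k]}.
suff -> : row b 1%:M = eval_row p by exact: eval_row_reduced.
have factorE a c : ((Z b ord0 (j c) - Z c ord0 (j c))^-1 *:
  ('X_(lshift k (j c)) - (Z c ord0 (j c))%:MP)).@[row_mx (Z a) q ord0] =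
  (Z b ord0 (j c) - Z c ord0 (j c))^-1 * (Z a ord0 (j c) - Z c ord0 (j c)).
  by rewrite mevalZ mevalB mevalXU mevalC row_mxEl.
apply/rowP => a; rewrite !mxE /eval_at /p rmorph_prod/=.
under eq_bigr do rewrite factorE.
have [<-|ba] := eqVneq b a.
  by rewrite big1// => c cb; rewrite mulVf// subr_eq0 jP// eq_sym.
by rewrite (bigD1 a)//= ?subrr ?mulr0 ?mul0r// eq_sym.
Qed.

End Bezout.

(** * Counting regular zeros *)

Section Counting.
Variable R : realType.

Lemma counting_ge (T : choiceType) (A : set T) (m : nat) (Z : 'I_m -> T) :
  injective Z -> (forall b, A (Z b)) -> ((m%:R)%:E <= counting A :> \bar R)%E.
Proof.
move=> injZ AZ; rewrite /counting; case: asboolP => [finA|_]; last exact: leey.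
rewrite lee_fin ler_nat -[m in (m <= _)%N](size_enum_ord m) -(size_map Z).
apply: uniq_leq_size; first by rewrite map_inj_uniq ?enum_uniq.
by move=> _ /mapP[b _ ->]; rewrite in_fset_set// inE; exact: AZ.
Qed.

Lemma counting_le (T : choiceType) (A : set T) (N : nat) :
  (forall Z : 'I_N.+1 -> T, injective Z -> ~ forall b, A (Z b)) ->
  (counting A <= (N%:R)%:E :> \bar R)%E.
Proof.
move=> noZ.
have noB (B : {fset T}) : (forall x, x \in B -> A x) -> (#|` B| <= N)%N.
  move=> BA; rewrite leqNgt; apply/negP => NB.
  have ltB (b : 'I_N.+1) : (b < size B)%N by apply: leq_trans (ltn_ord b) NB.
  have x0 : T by case: (enum_fset B) NB => [//|x0 ? _]; exact: x0.
  apply: (noZ (fun b => nth x0 B b)) => [b c /eqP|b].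
    by rewrite nth_uniq// => /eqP/val_inj.
  by apply: BA; rewrite mem_nth.
rewrite /counting; case: asboolP => [finA|infA].
  rewrite lee_fin ler_nat; apply: noB => x.
  by rewrite in_fset_set// inE.
have [B BA NB] := infinite_set_fset N.+1 infA.
by have := noB B BA; rewrite leqNgt NB.
Qed.

End Counting.
Section Zeros.
Variables (R : realType) (n k : nat).
Local Notation C := R[i].
Variable f : 'I_n -> {mpoly C[n + k]}.

(** F(.; q) has at least m regular zeros. *)
Definition has_regular_zeros (m : nat) (q : 'rV[C]_k) : Prop :=
  exists2 Z : 'I_m -> 'rV[C]_n, injective Z &
    forall b, is_regular_zero f q (Z b).

(** For a radius smaller than half of all the mutual distances, the zeros that
    persist near distinct regular zeros are distinct. *)
Lemma has_regular_zeros_perturb (g : 'I_n -> {mpoly C[n + k]}) m q0 :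
  has_regular_zeros m q0 ->
  exists2 d : R, 0 < d & forall t q, nc t < d -> l1 (q - q0) < d ->
    exists2 Z : 'I_m -> 'rV[C]_n, injective Z & forall b,
      (forall i, eval_at (f i + t *: g i) (Z b) q = 0) /\
      \det (jacobian f (Z b) q) <> 0.
Proof.
move=> [Z0 injZ0 regZ0].
have [eta eta0 etaP] : exists2 e, 0 < e & forall bc : 'I_m * 'I_m,
    bc.1 != bc.2 -> 2 * e < l1 (Z0 bc.1 - Z0 bc.2).
  apply: uniform_pos => [bc e e' ee' h /h|[b c]/=].
    by apply: le_lt_trans; rewrite ler_pM2l.
  have [->|bc] := eqVneq b c; first by exists 1.
  have D0 : 0 < l1 (Z0 b - Z0 c).
    rewrite ltNge; apply/negP => /l1_eq0/eqP; rewrite subr_eq0 => /eqP/injZ0.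
    by move/eqP: bc.
  by exists (l1 (Z0 b - Z0 c) / 4) => [|_]; lra.
have [d d0 dP] : exists2 d, 0 < d & forall b : 'I_m, forall t q,
    nc t < d -> l1 (q - q0) < d ->
    exists x, [/\ l1 (x - Z0 b) <= eta,
      forall i, eval_at (f i + t *: g i) x q = 0 &
      \det (jacobian f x q) <> 0].
  apply: uniform_pos => [b e e' ee' h t q te qe|b].
    by apply: h; [exact: lt_le_trans te ee' | exact: lt_le_trans qe ee'].
  exact: regular_zero_persists.
exists d => // t q td qd.
have /choice[Z hZ] := fun b => dP b t q td qd.
exists Z => [b c Zbc|b]; last by case: (hZ b).
apply/eqP/negPn/negP => bc.
have := etaP (b, c) bc; apply/negP; rewrite -leNgt/=.
apply: le_trans (l1_triangle _ (Z b) _) _; rewrite mulr2n mulrDl !mul1r.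
by apply: lerD; [rewrite l1B; case: (hZ b) | rewrite Zbc; case: (hZ c)].
Qed.

Lemma has_regular_zeros_open m q0 : has_regular_zeros m q0 ->
  exists2 d : R, 0 < d & forall q, l1 (q - q0) < d -> has_regular_zeros m q.
Proof.
move=> /(has_regular_zeros_perturb (fun=> 0))[d d0 hd]; exists d => // q qd.
have [|Z injZ hZ] := hd 0 q _ qd; first by rewrite Normc.normc0.
exists Z => // b; have [h1 h2] := hZ b; split=> // i.
by have := h1 i; rewrite scaler0 addr0.
Qed.

(** All the f_i have degree at most d = max_i msize (f i), hence the bound
    (d+1)^n; the perturbation parameter t is real, positive and small. *)
Lemma nb_regular_zeros_bounded : (0 < n)%N ->
  exists B : nat, forall m q, has_regular_zeros m q -> (m <= B)%N.
Proof.
move=> n_gt0; pose d := (\max_i msize (f i))%N.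
exists (d.+1 ^ n)%N => m q.
move=> /(has_regular_zeros_perturb (fun i => 'X_(lshift k i) ^+ d.+1))[e e0 he].
pose t : C := (e / 2)%:C%C.
have e2 : 0 < e / 2 by rewrite divr_gt0.
have [||Z injZ hZ] := he t q; first by rewrite normc_real gtr0_norm//; lra.
  by rewrite subrr l1_0.
apply: (@nb_zeros_perturbed R n k m d f t q Z) => //.
- by apply/eqP => /(congr1 (@complex.Re R)) /= /eqP; rewrite gt_eqF.
- by move=> i; rewrite leqW// /d leq_bigmax.
- by move=> b i; case: (hZ b).
Qed.

(** The parameters are the variables of index less than k, and the j-th
    coordinate of the a-th zero is the variable of index k + a n + j; these
    m n variables are quantified existentially. *)
Lemma definable_has_regular_zeros m : exists2 P : seq C -> Prop, definable P &
  forall v : 'I_k -> C, P (env_of v) <-> has_regular_zeros m (\row_l v l).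
Proof.
pose ix (a : 'I_m) (j : 'I_n) : nat := (k + (a * n + j))%N.
pose w (a : 'I_m) (i : 'I_(n + k)) : nat :=
  match split i with inl j => ix a j | inr l => l end.
pose z (e : seq C) a : 'rV[C]_n := \row_j e`_(ix a j).
pose q (e : seq C) : 'rV[C]_k := \row_l e`_l.
have evalE p e a : p.@[fun i => e`_(w a i)] = eval_at p (z e a) (q e).
  by apply: meval_eq => i; rewrite mxE /w; case: split => j; rewrite mxE.
pose P0 e := (forall a, is_regular_zero f (q e) (z e a)) /\
  forall ab : 'I_m * 'I_m, ab.1 != ab.2 -> z e ab.1 <> z e ab.2.
have defP0 : definable P0.
  apply: definable_and; apply: definable_forall; [move=> a|move=> [a b] /=].
    apply: (@definable_ext _ (fun e =>
        (forall i, (f i).@[fun i => e`_(w a i)] = 0) /\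
        ~ (jac_poly f).@[fun i => e`_(w a i)] = 0)).
      move=> e; rewrite evalE eval_jac_poly.
      by split=> -[h1 h2]; split=> // i; have := h1 i; rewrite evalE.
    apply: definable_and; last exact/definable_not/definable_mpoly_root.
    apply: definable_forall => i; exact: definable_mpoly_root.
  have [->|ab] := eqVneq a b.
    by exists (GRing.Bool true) => e /=; split=> // _; rewrite eqxx.
  apply: (@definable_ext _ (fun e => ~ forall j, e`_(ix a j) = e`_(ix b j))).
    move=> e; split=> [h _ /rowP eab|h eab].
      by apply: h => j; have := eab j; rewrite !mxE.
    by apply: h => //; apply/rowP => j; rewrite !mxE.
  apply/definable_not/definable_forall => j.
  by exists (GRing.Equal (GRing.Var _ (ix a j)) (GRing.Var _ (ix b j))).
exists (fun e => exists2 e' : seq C,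
    (forall x, x \notin iota k (m * n) -> e`_x = e'`_x) & P0 e').
  exact: definable_exists.
have qE v e' : (forall x, x \notin iota k (m * n) -> (env_of v)`_x = e'`_x) ->
    q e' = \row_l v l.
  move=> he; apply/rowP => l; rewrite !mxE -he ?nth_env_of//.
  by rewrite mem_iota leqNgt ltn_ord.
move=> v; split=> [[e' he [reg sep]]|[Z injZ regZ]].
  exists (z e') => [a b zab|a]; last by rewrite -(qE v e' he).
  by apply/eqP/negPn/negP => ab; exact: (sep (a, b) ab).
(* The index a n + j decodes to a by division and to j by remainder; the
   alternatives 0 are never taken. *)
pose e' : seq C := env_of v ++
  [seq (if insub (x %/ n)%N is Some a then
         if insub (x %% n)%N is Some j then Z a ord0 j else 0 else 0)
     | x <- iota 0 (m * n)].
have se : size (env_of v) = k by rewrite size_map size_enum_ord.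
have he' x : x \notin iota k (m * n) -> (env_of v)`_x = e'`_x.
  rewrite mem_iota negb_and -ltnNge -leqNgt nth_cat se => /orP[->//|kx].
  have [xk|kx'] := ltnP x k => //; rewrite !nth_default ?se//.
  by rewrite size_map size_iota leq_subRL.
have ze a : z e' a = Z a.
  apply/rowP => j; rewrite mxE nth_cat se /ix ltnNge leq_addr/= addKn.
  have lt_mn : (a * n + j < m * n)%N.
    apply: (@leq_trans (a.+1 * n)); first by rewrite mulSn addnC ltn_add2r.
    by rewrite leq_mul2r ltn_ord orbT.
  rewrite (nth_map 0%N) ?size_iota// nth_iota// add0n.
  have n0 : (0 < n)%N by apply: leq_ltn_trans (ltn_ord j).
  rewrite divnMDl// divn_small// addn0 valK modnMDl modn_small//.
  by rewrite valK.
exists e' => //; split=> [a|[a b]/= ab].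
  by rewrite (qE v e' he') ze.
by rewrite !ze => /injZ/eqP; rewrite (negbTE ab).
Qed.

Lemma generically_has_regular_zeros m q0 : has_regular_zeros m q0 ->
  generically (fun v : 'I_k -> C => has_regular_zeros m (\row_l v l)).
Proof.
move=> hq0; have [P defP hP] := definable_has_regular_zeros m.
(* The generic failure alternative is refuted by a point near q0 where g does
   not vanish. *)
case: (generically_definable k defP) => [|[g g0 hg]].
  by apply: generically_imp => v /hP.
have [d d0 hd] := has_regular_zeros_open hq0.
pose S (l : 'I_k) (c : C) := nc (c - q0 ord0 l) < d / k.+1%:R.
have infS l (s : seq C) : exists2 c, S l c & c \notin s.
  pose h (j : nat) : C := q0 ord0 l + (d / k.+1%:R / j.+2%:R)%:C%C.
  have dk : 0 < d / k.+1%:R by rewrite divr_gt0.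
  have injh : injective h.
    move=> i j /addrI/complexI/mulfI; rewrite gt_eqF// => /(_ isT)/invr_inj/eqP.
    by rewrite eqr_nat => /eqP[].
  have Sh j : S l (h j).
    rewrite /S /h [X in nc X]addrC addKr normc_real ger0_norm; last first.
      by rewrite divr_ge0// ltW.
    by rewrite ltr_pdivrMr// ltr_pMr// ltr1n.
  by have [j hj] := injective_notin_seq s injh; exists (h j).
have [v Sv gv] := mpoly_nonroot_in infS g0.
case: (hg v gv); apply/hP/hd.
have dk : 0 < d / k.+1%:R by rewrite divr_gt0.
apply: (@le_lt_trans _ _ (\sum_(l < k) (d / k.+1%:R))).
  by apply: ler_sum => l _; rewrite !mxE; exact: ltW (Sv l).
rewrite sumr_const card_ord -[_ *+ k]mulr_natr -mulrA gtr_pMr//.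
by rewrite mulrC ltr_pdivrMr// mul1r ltr_nat.
Qed.

End Zeros.

Local Open Scope classical_set_scope.

Theorem theorem1p1 (R : realType) (n k : nat) (n_gt0 : (0 < n)%N)
    (k_gt0 : (0 < k)%N) (f : 'I_n -> {mpoly R[i][n + k]}) :
  (sup_nb_regular_zeros f < +oo)%E /\
  exists Delta : set 'rV[R[i]]_k,
    [/\ algebraic_subvariety Delta,
        Delta `<` setT &
        forall q : 'rV[R[i]]_k, (~` Delta) q ->
          nb_regular_zeros f q = sup_nb_regular_zeros f].
Proof.
have [B hB] := nb_regular_zeros_bounded f n_gt0.
have ex0 : exists m, `[< exists q, has_regular_zeros f m q >].
  by exists 0%N; apply/asboolP; exists 0, (fun=> 0) => -[].
have ubB m : `[< exists q, has_regular_zeros f m q >] -> (m <= B)%N.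
  by move=> /asboolP[q /hB].
case: (ex_maxnP ex0 ubB) => N /asboolP[q0 hq0] maxN.
have le_N q : (nb_regular_zeros f q <= (N%:R)%:E)%E.
  apply: counting_le => Z injZ hZ.
  suff : (N.+1 <= N)%N by rewrite ltnn.
  by apply/maxN/asboolP; exists q, Z.
have ge_N q : has_regular_zeros f N q -> ((N%:R)%:E <= nb_regular_zeros f q)%E.
  by move=> [Z injZ hZ]; exact: (counting_ge _ injZ).
have supN : sup_nb_regular_zeros f = (N%:R)%:E.
  apply/eqP; rewrite eq_le; apply/andP; split.
    by apply: ge_ereal_sup => _ [q _ <-]; exact: le_N.
  by apply: le_trans (ge_N q0 hq0) _; apply: ereal_sup_ubound; exists q0.
split; first by rewrite supN ltry.
have [g g0 hg] := generically_has_regular_zeros hq0.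
exists [set q | forall h, [set g] h -> h.@[q ord0] = 0]; split.
- by exists [set g].
- split=> [//|full].
  have unbounded (i : 'I_k) (s : seq R[i]) :
      exists2 c, (fun _ _ => True) i c & c \notin s.
    have injN : injective (fun j : nat => j%:R : R[i]).
      by move=> a b /eqP; rewrite eqr_nat => /eqP.
    by have [j hj] := injective_notin_seq s injN; exists j%:R.
  have [v _ gv] := mpoly_nonroot_in unbounded g0.
  have := full (\row_l v l) I g erefl.
  rewrite -[LHS](_ : g.@[v] = _) => [/eqP|]; first by rewrite (negbTE gv).
  by apply: meval_eq => l; rewrite mxE.
- move=> q /= nDq; rewrite supN; apply/eqP; rewrite eq_le le_N ge_N//.
  have gq : g.@[q ord0] != 0 by apply/eqP => gq; apply: nDq => _ ->.
  have := hg (q ord0) gq; congr (has_regular_zeros _ _ _).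
  by apply/rowP => l; rewrite mxE.
Qed.
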